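(* Let $T$ be a truss and let $f,g\colon G\to H$ be morphisms of heaps of $T$-modules with $G$ non-empty (hence $H$ non-empty). Fix associated pointed $T$-module structures $(G,+)$ and $(H,+)$ on $G$ and $H$, and write $f=\alpha+a$ and $g=\beta+b$, where $\alpha,\beta\colon (G,+)\to(H,+)$ are morphisms of pointed $T$-modules and $a,b\in H$. Let $C$ be the heap of $T$-modules associated with the quotient pointed $T$-module $H/(\mathrm{Im}(\alpha-\beta)+\langle a-b\rangle_T)$, where $\langle a-b\rangle_T$ is the pointed $T$-submodule of $(H,+)$ generated by $a-b$, and let $\pi_C\colon H\to C$ be the canonical surjection. Then $(C,\pi_C)$ is the coequalizer of the pair $(f,g)$ in the category of heaps of $T$-modules.
   Context: An abelian heap is a (possibly empty) set $H$ with a ternary operation $[-,-,-]$ satisfying $[a,b,[c,d,e]]=[[a,b,c],d,e]$, $[a,b,b]=a=[b,b,a]$ and $[a,b,c]=[c,b,a]$; heap morphisms preserve the bracket. A truss is an abelian heap $T$ with an associative binary multiplication such that $t[s,s',s'']=[ts,ts',ts'']$ and $[s,s',s'']t=[st,s't,s''t]$ (not assumed unital, possibly empty). A left $T$-module is an abelian heap $M$ with an action $\cdot\colon T\times M\to M$ with $t\cdot(t'\cdot m)=(tt')\cdot m$, $[t,t',t'']\cdot m=[t\cdot m,t'\cdot m,t''\cdot m]$, $t\cdot[m,n,e]=[t\cdot m,t\cdot n,t\cdot e]$. A heap of $T$-modules is an abelian heap $M$ (possibly empty) with an operation $T\times M\times M\to M$, $(t,m,n)\mapsto t\triangleright_m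 n$, such that for each $m\in M$ the map $(t,n)\mapsto t\triangleright_m n$ makes $M$ a left $T$-module, and $t\triangleright_m n=[t\triangleright_e n,t\triangleright_e m,m]$ for all $m,n,e\in M$, $t\in T$. Morphisms are heap morphisms $f$ with $f(t\triangleright_m n)=t\triangleright_{f(m)}f(n)$. A pointed $T$-module is an abelian group $G$ with a map $\cdot\colon T\times G\to G$ such that $t\cdot(t'\cdot g)=(tt')\cdot g$, $[t,t',t'']\cdot g=t\cdot g-t'\cdot g+t''\cdot g$ and $t\cdot(g+h)=t\cdot g+t\cdot h$. Morphisms are group homomorphisms $f$ with $f(t\cdot g)=t\cdot f(g)$. A pointed $T$-submodule is a subgroup closed under the $T$-action. A pointed $T$-module $G$ has an associated heap of $T$-modules with $[x,y,z]=x-y+z$ and $t\triangleright_x y=t\cdot y-t\cdot x+x$. Conversely, for a non-empty heap of $T$-modules $(M,\triangleright)$ and $e\in M$, an associated pointed $T$-module structure is the abelian group on $M$ with addition $x+y=[x,e,y]$ (zero $e$) and action $t\cdot x=t\triangleright_e x$. With respect to chosen associated structures on $M$ and $N$ (zero of $M$ denoted $0$), each morphism $f\colon M\to N$ of heaps of $T$-modules can be written uniquely as $f=\alpha+f(0)$ with $\alpha$ a morphism of pointed $T$-modules. *)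

(* Defs.v *)
From HB Require Import structures.
From mathcomp Require Import all_boot all_algebra boolp.

Set Implicit Arguments.
Unset Strict Implicit.
Unset Printing Implicit Defensive.

Import GRing.Theory.
Local Open Scope ring_scope.
Local Open Scope quotient_scope.

(* Carriers of heaps are arbitrary types, possibly empty. *)
HB.mixin Record isAbelianHeap (H : Type) := {
  bracket : H -> H -> H -> H;
  bracketA : forall a b c d e,
    bracket a b (bracket c d e) = bracket (bracket a b c) d e;
  bracketKr : forall a b, bracket a b b = a;
  bracketKl : forall a b, bracket b b a = a;
  bracketC : forall a b c, bracket a b c = bracket c b a
}.

#[short(type="abelianHeapType")]
HB.structure Definition AbelianHeap := {H of isAbelianHeap H}.

HB.mixin Record AbelianHeap_isTruss (T : Type) of AbelianHeap T := {
  tmul : T -> T -> T;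
  tmulA : forall s t u, tmul s (tmul t u) = tmul (tmul s t) u;
  tmul_bracketr : forall t s s' s'' : T,
    tmul t (bracket s s' s'') = bracket (tmul t s) (tmul t s') (tmul t s'');
  tmul_bracketl : forall t s s' s'' : T,
    tmul (bracket s s' s'') t = bracket (tmul s t) (tmul s' t) (tmul s'' t)
}.

#[short(type="trussType")]
HB.structure Definition Truss := {T of AbelianHeap_isTruss T & AbelianHeap T}.

Definition is_left_module (T : trussType) (M : abelianHeapType)
    (act : T -> M -> M) : Prop :=
  [/\ forall t t' m, act t (act t' m) = act (tmul t t') m,
      forall t t' t'' m,
        act (bracket t t' t'') m = bracket (act t m) (act t' m) (act t'' m)
    & forall t m n e,
        act t (bracket m n e) = bracket (act t m) (act t n) (act t e)].

(* [hact t m n] is t |>_m n: the base point of the action comes second. *)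
HB.mixin Record AbelianHeap_isHeapOfModules (T : trussType) (M : Type)
    of AbelianHeap M := {
  hact : T -> M -> M -> M;
  hact_module : forall m : M, is_left_module (fun t n => hact t m n);
  hact_base : forall t (m n e : M),
    hact t m n = bracket (hact t e n) (hact t e m) m
}.

#[short(type="heapModType")]
HB.structure Definition HeapOfModules (T : trussType) :=
  {M of AbelianHeap_isHeapOfModules T M & AbelianHeap M}.

Definition heapmod_morphism (T : trussType) (M N : heapModType T)
    (f : M -> N) : Prop :=
  (forall x y z, f (bracket x y z) = bracket (f x) (f y) (f z)) /\
  (forall (t : T) m n, f (hact t m n) = hact t (f m) (f n)).

Definition is_coequalizer (T : trussType) (G H C : heapModType T)
    (f g : G -> H) (p : H -> C) : Prop :=
  [/\ heapmod_morphism p,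
      p \o f =1 p \o g
    & forall (E : heapModType T) (h : H -> E),
        heapmod_morphism h -> h \o f =1 h \o g ->
        exists k : C -> E,
          [/\ heapmod_morphism k,
              k \o p =1 h
            & forall k' : C -> E,
                heapmod_morphism k' -> k' \o p =1 h -> k' =1 k]].

HB.mixin Record Zmodule_isPointedModule (T : trussType) (G : Type)
    of GRing.Zmodule G := {
  pact : T -> G -> G;
  pactA : forall t t' g, pact t (pact t' g) = pact (tmul t t') g;
  pact_bracket : forall t t' t'' g,
    pact (bracket t t' t'') g = pact t g - pact t' g + pact t'' g;
  pactD : forall t g h, pact t (g + h) = pact t g + pact t h
}.

#[short(type="pointedModType")]
HB.structure Definition PointedModule (T : trussType) :=
  {G of Zmodule_isPointedModule T G & GRing.Zmodule G}.

HB.mixin Record isActionMorphism (T : trussType) (G H : pointedModType T)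
    (f : G -> H) := {
  morph_pact : forall (t : T) x, f (pact t x) = pact t (f x)
}.

HB.structure Definition PointedMorphism (T : trussType)
    (G H : pointedModType T) :=
  {f of isActionMorphism T G H f & @GRing.Additive G H f}.

Notation "{ 'pointed' G -> H }" := (PointedMorphism.type G%type H%type)
  (at level 0, G at level 98, H at level 99,
   format "{ 'pointed'  G  ->  H }") : type_scope.

HB.mixin Record isActionClosed (T : trussType) (G : pointedModType T)
    (S : {pred G}) := {
  pact_closed : forall (t : T) x, x \in S -> pact t x \in S
}.

#[short(type="pointedSubmod")]
HB.structure Definition PointedSubmodule (T : trussType)
    (G : pointedModType T) :=
  {S of isActionClosed T G S & @GRing.ZmodClosed G S}.

Section PointedTheory.
Variables (T : trussType) (G : pointedModType T).

Lemma pact_is_zmod_morphism (t : T) : zmod_morphism (@pact T G t).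
Proof.
move=> x y; apply: (addIr (pact t y)).
by rewrite -pactD !subrK.
Qed.

HB.instance Definition _ (t : T) :=
  GRing.isZmodMorphism.Build G G (@pact T G t) (pact_is_zmod_morphism t).

End PointedTheory.

Section SubMorphism.
Variables (T : trussType) (G H : pointedModType T) (f g : {pointed G -> H}).

Lemma sub_morph_pact (t : T) x : (f \- g) (pact t x) = pact t ((f \- g) x).
Proof. by rewrite /= !morph_pact raddfB. Qed.

HB.instance Definition _ :=
  isActionMorphism.Build T G H (f \- g) sub_morph_pact.

End SubMorphism.

(* Membership predicates are boolean, hence the [asbool] brackets. *)
Definition im (U V : Type) (h : U -> V) : {pred V} :=
  fun y => `[< exists x, y = h x >].

Definition sum_pred (G : zmodType) (A B : {pred G}) : {pred G} :=
  fun z => `[< exists x y, [/\ x \in A, y \in B & z = x + y] >].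

Definition gen (T : trussType) (G : pointedModType T) (x : G) : {pred G} :=
  fun y => `[< forall S : pointedSubmod G, x \in S -> y \in S >].

Section ImSubmodule.
Variables (T : trussType) (G H : pointedModType T) (h : {pointed G -> H}).

Lemma im_zmod_closed : zmod_closed (im h).
Proof.
split=> [|_ _ /asboolP[x ->] /asboolP[y ->]]; apply/asboolP.
  by exists 0; rewrite raddf0.
by exists (x - y); rewrite raddfB.
Qed.

HB.instance Definition _ := GRing.isZmodClosed.Build H (im h) im_zmod_closed.

Lemma im_pact_closed (t : T) y : y \in im h -> pact t y \in im h.
Proof.
by move=> /asboolP[x ->]; apply/asboolP; exists (pact t x); rewrite morph_pact.
Qed.

HB.instance Definition _ := isActionClosed.Build T H (im h) im_pact_closed.

End ImSubmodule.

Section SumSubmodule.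
Variables (T : trussType) (G : pointedModType T) (A B : pointedSubmod G).

Lemma sum_zmod_closed : zmod_closed (sum_pred A B).
Proof.
split=> [|_ _ /asboolP[x [y [Ax By ->]]] /asboolP[x' [y' [Ax' By' ->]]]].
  by apply/asboolP; exists 0, 0; rewrite !rpred0 addr0.
by apply/asboolP; exists (x - x'), (y - y'); rewrite !rpredB // opprD addrACA.
Qed.

HB.instance Definition _ :=
  GRing.isZmodClosed.Build G (sum_pred A B) sum_zmod_closed.

Lemma sum_pact_closed (t : T) z :
  z \in sum_pred A B -> pact t z \in sum_pred A B.
Proof.
move=> /asboolP[x [y [Ax By ->]]]; apply/asboolP.
by exists (pact t x), (pact t y); rewrite !pact_closed // pactD.
Qed.

HB.instance Definition _ :=
  isActionClosed.Build T G (sum_pred A B) sum_pact_closed.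

End SumSubmodule.

Section GenSubmodule.
Variables (T : trussType) (G : pointedModType T) (x : G).

Lemma gen_zmod_closed : zmod_closed (gen x).
Proof.
split=> [|y z /asboolP gy /asboolP gz]; apply/asboolP => S Sx.
  exact: rpred0.
by rewrite rpredB ?gy ?gz.
Qed.

HB.instance Definition _ := GRing.isZmodClosed.Build G (gen x) gen_zmod_closed.

Lemma gen_pact_closed (t : T) y : y \in gen x -> pact t y \in gen x.
Proof.
by move=> /asboolP gy; apply/asboolP => S Sx; rewrite pact_closed ?gy.
Qed.

HB.instance Definition _ := isActionClosed.Build T G (gen x) gen_pact_closed.

End GenSubmodule.

Section QuotientModule.
Variables (T : trussType) (G : pointedModType T) (N : pointedSubmod G).

Local Notation Q := (Quotient.quot N).

Definition quot_pact (t : T) : Q -> Q := lift_op1 Q (pact t).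

Lemma pi_pact (t : T) (x : G) : \pi_Q (pact t x) = quot_pact t (\pi_Q x).
Proof.
unlock quot_pact; apply/eqP; rewrite -Quotient.idealrBE -raddfB.
by apply: pact_closed; rewrite Quotient.idealrBE reprK.
Qed.

Lemma quot_pactA (t t' : T) (x : Q) :
  quot_pact t (quot_pact t' x) = quot_pact (tmul t t') x.
Proof. by rewrite -[x]reprK -!pi_pact pactA. Qed.

Lemma quot_pact_bracket (t t' t'' : T) (x : Q) :
  quot_pact (bracket t t' t'') x
  = quot_pact t x - quot_pact t' x + quot_pact t'' x.
Proof. by rewrite -[x]reprK -!pi_pact pact_bracket !piE. Qed.

Lemma quot_pactD (t : T) (x y : Q) :
  quot_pact t (x + y) = quot_pact t x + quot_pact t y.
Proof.
by rewrite -[x]reprK -[y]reprK -raddfD -!pi_pact pactD raddfD.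
Qed.

HB.instance Definition _ := Zmodule_isPointedModule.Build T Q
  quot_pactA quot_pact_bracket quot_pactD.

End QuotientModule.

Definition heap_of (T : trussType) (G : pointedModType T) : Type := G.

Section HeapOf.
Variables (T : trussType) (G : pointedModType T).

Let br (x y z : G) := x - y + z.
Let ha (t : T) (x y : heap_of G) : heap_of G :=
  pact t (y : G) - pact t (x : G) + (x : G).

Lemma heap_of_bracketA a b c d e : br a b (br c d e) = br (br a b c) d e.
Proof. by rewrite /br !addrA. Qed.

Lemma heap_of_bracketKr a b : br a b b = a.
Proof. exact: subrK. Qed.

Lemma heap_of_bracketKl a b : br b b a = a.
Proof. by rewrite /br subrr add0r. Qed.

Lemma heap_of_bracketC a b c : br a b c = br c b a.
Proof. by rewrite /br addrC addrA addrAC. Qed.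

HB.instance Definition _ := isAbelianHeap.Build (heap_of G)
  heap_of_bracketA heap_of_bracketKr heap_of_bracketKl heap_of_bracketC.

Let bracket_translate (a b c d e k m : G) :
  a - b + c - (d - e + k) + m = (a - d + m) - (b - e + m) + (c - k + m).
Proof.
rewrite !opprD !opprK !addrA [RHS](ACl (1*4*7*2*5*8*9*3*6))%AC.
by rewrite /= addrK.
Qed.

Lemma heap_of_hact_module (m : heap_of G) :
  @is_left_module T (heap_of G) (fun t n => ha t m n).
Proof.
split=> [t t' n|t t' t'' n|t n p q]; rewrite /ha.
- by rewrite pactD raddfB /= !pactA addrK.
- by rewrite !pact_bracket; apply: bracket_translate.
- rewrite pactD raddfB /=.
  have := bracket_translate (pact t n) (pact t p) (pact t q)
            (pact t m) (pact t m) (pact t m) m.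
  by rewrite subrr add0r.
Qed.

Lemma heap_of_hact_base t (m n e : heap_of G) :
  ha t m n = bracket (ha t e n) (ha t e m) m.
Proof.
rewrite /bracket /= /br /ha opprD opprB !addrA.
by rewrite (addrAC _ (e : G) (pact t (e : G))) subrK (addrAC _ (e : G)) addrK.
Qed.

HB.instance Definition _ := AbelianHeap_isHeapOfModules.Build T (heap_of G)
  heap_of_hact_module heap_of_hact_base.

End HeapOf.

(* [pointed_at e] is the carrier of the heap of modules, with e as zero. The
   choice structure demanded by [zmodType] comes from the classical axioms. *)
Definition pointed_at (T : trussType) (M : heapModType T) (e : M) : Type := M.

Section PointedAt.
Variables (T : trussType) (M : heapModType T) (e : M).

Let add (x y : M) := bracket x e y.
Let opp (x : M) := bracket e x e.

Lemma pointed_at_addA : associative add.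
Proof. by move=> x y z; rewrite /add bracketA. Qed.

Lemma pointed_at_addC : commutative add.
Proof. by move=> x y; rewrite /add bracketC. Qed.

Lemma pointed_at_add0 : left_id e add.
Proof. by move=> x; rewrite /add bracketKl. Qed.

Lemma pointed_at_addN : left_inverse e opp add.
Proof. by move=> x; rewrite /add /opp -bracketA bracketKl bracketKr. Qed.

HB.instance Definition _ := gen_eqMixin (pointed_at e).
HB.instance Definition _ := gen_choiceMixin (pointed_at e).
HB.instance Definition _ := GRing.isZmodule.Build (pointed_at e)
  pointed_at_addA pointed_at_addC pointed_at_add0 pointed_at_addN.

Let act (t : T) (x : pointed_at e) : pointed_at e := hact t e x.

Lemma pointed_at_bracket (x y z : pointed_at e) :
  (bracket (x : M) y z : pointed_at e) = x - y + z.
Proof.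
rewrite /GRing.add /= /add /GRing.opp /= /opp.
by rewrite (bracketA x e e) bracketKr -bracketA bracketKl.
Qed.

Lemma hact_idem (t : T) (m : M) : hact t m m = m.
Proof. by rewrite (hact_base t m m m) bracketKl. Qed.

Lemma pointed_at_pactA t t' x : act t (act t' x) = act (tmul t t') x.
Proof. by case: (@hact_module T M e) => + _ _; apply. Qed.

Lemma pointed_at_pact_bracket t t' t'' x :
  act (bracket t t' t'') x = act t x - act t' x + act t'' x.
Proof.
rewrite -pointed_at_bracket.
by case: (@hact_module T M e) => _ + _; apply.
Qed.

Lemma pointed_at_pactD t x y : act t (x + y) = act t x + act t y.
Proof.
case: (@hact_module T M e) => _ _ /(_ t x e y).
by rewrite hact_idem.
Qed.

HB.instance Definition _ := Zmodule_isPointedModule.Build T (pointed_at e)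
  pointed_at_pactA pointed_at_pact_bracket pointed_at_pactD.

End PointedAt.

(* Main.v *)
Require Import Defs.
From HB Require Import structures.
From mathcomp Require Import all_boot all_algebra boolp.

Set Implicit Arguments.
Unset Strict Implicit.
Unset Printing Implicit Defensive.

Import GRing.Theory.
Local Open Scope ring_scope.
Local Open Scope quotient_scope.

(** A morphism [h] out of [H] identifies [x] and [y] exactly when [x - y] lies
    in the pointed submodule [{x | h x = h 0}]. If [h \o f = h \o g], this
    submodule contains [a - b = f 0 - g 0] and every
    [(alpha - beta) x = (f x - g x) - (a - b)], hence the submodule we quotient
    by, and [h] factors through the quotient. *)

Lemma hact_pointed (T : trussType) (M : heapModType T) (e : M) (t : T)
    (m n : pointed_at e) :
  hact t (m : M) n = pact t n - pact t m + m.
Proof. by rewrite (hact_base t m n e) -pointed_at_bracket. Qed.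

(** The proof [hh] is an argument so that the submodule structures declared below, which rest on it,
    are inferred from the predicate itself. *)
Definition heap_ker (T : trussType) (M N : heapModType T) (e : M)
    (h : M -> N) (hh : heapmod_morphism h) : {pred pointed_at e} :=
  fun x => `[< h x = h e >].
Arguments heap_ker {T M N} e {h} hh _.

Section HeapKernel.
Variables (T : trussType) (M N : heapModType T) (e : M) (h : M -> N).
Hypothesis hh : heapmod_morphism h.

Local Notation K := (heap_ker e hh).

(** Since [e] is the zero, [x = [x - y, e, y]] and [x - y = [x, y, e]]; [h] preserves both
    brackets. *)
Lemma sub_heap_ker (x y : pointed_at e) : (x - y \in K) <-> h x = h y.
Proof.
split=> [/asboolP hxy|hxy].
  have -> : x = bracket (x - y : M) e y by rewrite pointed_at_bracket subr0 subrK.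
  by rewrite (proj1 hh) hxy bracketKl.
apply/asboolP; rewrite -[x - y]addr0 -pointed_at_bracket (proj1 hh) hxy.
exact: bracketKl.
Qed.

Lemma heap_ker_zmod_closed : zmod_closed K.
Proof.
split=> [|x y /asboolP hx /asboolP hy]; first exact/asboolP.
by apply/sub_heap_ker; rewrite hx hy.
Qed.

HB.instance Definition _ :=
  GRing.isZmodClosed.Build (pointed_at e) K
    heap_ker_zmod_closed.

Lemma heap_ker_pact_closed (t : T) (x : pointed_at e) :
  x \in K -> pact t x \in K.
Proof.
move=> /asboolP hx; apply/asboolP.
(* [pact t x] is the action based at [e], which [h] carries to the action based at [h e]; that
   action fixes [h e]. *)
by rewrite [LHS](proj2 hh) hx hact_idem.
Qed.

HB.instance Definition _ :=
  isActionClosed.Build T (pointed_at e) K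
    heap_ker_pact_closed.

End HeapKernel.

Section QuotientMorphism.
Variables (T : trussType) (M : heapModType T) (e : M).
Variable S : pointedSubmod (pointed_at e).

Local Notation Q := (Quotient.quot S).
Local Notation p := (\pi_Q : pointed_at e -> Q).

Lemma pi_heapmod_morphism : @heapmod_morphism T M (heap_of Q) p.
Proof.
split=> [x y z|t m n].
  by rewrite (pointed_at_bracket (e := e)) raddfD raddfB.
by rewrite (hact_pointed (e := e)) raddfD raddfB /= !pi_pact.
Qed.

Lemma heapmod_morphism_factor (E : heapModType T) (h : M -> E)
    (hh : heapmod_morphism h) :
  {subset S <= heap_ker e hh} ->
  exists k : heap_of Q -> E,
    [/\ heapmod_morphism k,
        k \o p =1 h
      & forall k' : heap_of Q -> E,
          heapmod_morphism k' -> k' \o p =1 h -> k' =1 k].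
Proof.
move=> SK.
(* The choice of representative is harmless: [repr (p x) - x] lies in [S], hence in the kernel of
   [h]. *)
pose k (q : heap_of Q) : E := h (repr (q : Q)).
have kp x : k (p x) = h x.
  apply/(sub_heap_ker hh)/SK.
  by rewrite Quotient.idealrBE reprK.
have pS (q : heap_of Q) : exists x, q = p x.
  by exists (repr (q : Q)); rewrite reprK.
have [pb pa] := pi_heapmod_morphism.
exists k; split=> [||k' _ k'p q] //.
  split=> [q1 q2 q3|t q1 q2].
    have [x1 ->] := pS q1; have [x2 ->] := pS q2; have [x3 ->] := pS q3.
    by rewrite -pb !kp (proj1 hh).
  have [x1 ->] := pS q1; have [x2 ->] := pS q2.
  by rewrite -pa !kp (proj2 hh).
by have [x ->] := pS q; rewrite kp -k'p.
Qed.

End QuotientMorphism.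

Theorem mainTheorem5 (T : trussType) (G H : heapModType T) (f g : G -> H)
    (hf : heapmod_morphism f) (hg : heapmod_morphism g) (eG : G) (eH : H)
    (alpha beta : {pointed pointed_at eG -> pointed_at eH})
    (a b : pointed_at eH)
    (f_def : forall x : G, f x = alpha x + a)
    (g_def : forall x : G, g x = beta x + b) :
  let Q := Quotient.quot (sum_pred (im (alpha \- beta)) (gen (a - b))) in
  is_coequalizer (C := heap_of Q) f g (\pi_Q : pointed_at eH -> Q).
Proof.
have fgB (x : G) :
    (f x : pointed_at eH) - (g x : pointed_at eH) =
      (alpha \- beta) x + (a - b).
  by rewrite f_def g_def /= opprD addrACA.
move=> Q; split=> [|x|E h hh hfg]; first exact: pi_heapmod_morphism.
  apply/eqP; rewrite /= -Quotient.idealrBE fgB; apply/asboolP.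
  exists ((alpha \- beta) x), (a - b); split=> //; apply/asboolP.
    by exists x.
  by move=> S.
have fgK (z : G) : (alpha \- beta) z + (a - b) \in heap_ker eH hh.
  by rewrite -fgB; apply/sub_heap_ker/hfg.
have abK : a - b \in heap_ker eH hh.
  have := fgK eG.
  (* [eG] is the zero of [pointed_at eG], so only [a - b] survives there. *)
  have -> : (alpha \- beta) eG = 0 by exact: (raddf0 (alpha \- beta)).
  by rewrite add0r.
apply: (heapmod_morphism_factor (hh := hh)) => z /asboolP[_ [y [/asboolP[x ->]]]].
(* The kernel of [h] is one of the submodules containing [a - b] over which [gen] quantifies. *)
move=> /asboolP/(_ _ abK) yK ->; rewrite rpredD //.
by rewrite -[X in X \in _](addrK (a - b)) rpredB ?fgK.
Qed.
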